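(* Let $\mathcal{X}=\mathrm{Gras}_{\mathbb{B}}(W)$ with its product map $\Gamma:D(\Gamma)\to\mathcal{X}$ and its dilation maps $\Pi_s:D(\Pi_s)\to\mathcal{X}$ ($s\in\mathbb{K}$). Then: (i) For fixed $a,b\in\mathcal{X}$, the set $C_{ab}$ with product $(xyz):=\Gamma(x,a,y,b,z)$ is a torsor (denoted $U_{ab}$); in particular $C_{ab}$ is stable under this product. In particular, for a triple $(a,y,b)$ with $y\in C_{ab}$, $C_{ab}$ is a group with unit $y$ and multiplication $xz=\Gamma(x,a,y,b,z)$. (ii) The map $\Gamma$ is symmetric under the permutation $(15)(24)$ (reversal of arguments): $\Gamma(x,a,y,b,z)=\Gamma(z,b,y,a,x)$ on $D(\Gamma)$. In other words, $U_{ab}$ is the opposite torsor of $U_{ba}$ (same set with reversed product). In particular, the torsor $U_a:=U_{aa}$ is commutative. (iii) The commutative torsor $U_a$ is the underlying additive torsor of an affine space: for any $a\in\mathcal{X}$, $U_a$ is an affine space over $\mathbb{K}$, with additive structure given by $$x+_y z=\Gamma(x,a,y,a,z)$$ (sum of $x$ and $z$ with respect to the origin $y$), and action of scalars given by $$s y+(1-s)x=\Pi_s(x,a,y)$$ (multiplication of $y$ by $s$ with respect to the origin $x$).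
   Context: $\mathbb{K}$ is a commutative unital ring, $\mathbb{B}$ an associative unital $\mathbb{K}$-algebra, $W$ a right $\mathbb{B}$-module, and $\mathcal{X}=\mathrm{Gras}_{\mathbb{B}}(W)$ is the set of all $\mathbb{B}$-submodules of $W$. For $x,a\in\mathcal{X}$ write $x\top a$ if $W=x\oplus a$. Put $C_a=\{x\in\mathcal{X}: x\top a\}$ and $C_{ab}=C_a\cap C_b$ (possibly empty); so $C_{aa}=C_a$. If $x\top a$, $P_x^a:W\to W$ is the projector onto $x$ with kernel $a$ (lower index: image, upper index: kernel). For a $\mathbb{B}$-linear $f:W\to W$, $[f]$ is its class modulo multiplication by $\mathbb{K}^\times$; it acts on $\mathcal{X}$ by $[f](y)=f(y)$ (image of the submodule $y$). Define $M_{xabz}=[P_x^a-P_b^z]$ if $a\top x$, $z\top b$; $L_{xayb}=[1-P_a^xP_y^b]$ if $a\top x$, $y\top b$; $R_{aybz}=[1-P_b^zP_y^a]$ if $a\top y$, $z\top b$. Let $D_L$ be the set of $(x,a,y,b,z)\in\mathcal{X}^5$ with $x\top a$ and $y\top b$; $D_R$ those with $y\top a$ and $z\top b$; $D_M$ those with $x\top a$, $z\top b$ and $C_{ab}\neq\emptyset$; $D(\Gamma)=D_L\cup D_R\cup D_M$. The map $\Gamma:D(\Gamma)\to\mathcal{X}$ is (well-)defined by $\Gamma(x,a,y,b,z)=L_{xayb}(z)$ on $D_L$, $=R_{aybz}(x)$ on $D_R$, $=M_{xabz}(y)$ on $D_M$. For $s\in\mathbb{K}$ and $x\top a$ let $\delta^{(s)}_{xa}=[sP_a^x+P_x^a]$.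 Let $D(\Pi_s)=\{(x,a,z)\in\mathcal{X}^3: x\top a\text{ or }z\top a\}$, and (well-)define $\Pi_s:D(\Pi_s)\to\mathcal{X}$ by $\Pi_s(x,a,z)=\delta^{(s)}_{xa}(z)$ if $x\top a$, and $=\delta^{(1-s)}_{za}(x)$ if $z\top a$. A torsor is a (possibly empty) set $G$ with a ternary map $(x,y,z)\mapsto(xyz)$ satisfying $(xy(zuv))=((xyz)uv)$ and $(xxy)=y=(yxx)$. The opposite torsor has product $(x,y,z)\mapsto(zyx)$; a torsor is commutative if $(xyz)=(zyx)$. An affine space over $\mathbb{K}$ is a (possibly empty) set which, after the choice of any origin $y$, is a $\mathbb{K}$-module with zero $y$, addition $x+_yz=x-y+z$ and scalar multiplication $s\cdot_y x=(1-s)y+sx$, the structures for different origins being related by translation. *)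

(* Defs.v *)
From HB Require Import structures.
From mathcomp Require Import all_boot all_order all_algebra.
From mathcomp Require Import boolp classical_sets functions.

Set Implicit Arguments.
Unset Strict Implicit.
Unset Printing Implicit Defensive.

Import GRing.Theory.
Local Open Scope classical_set_scope.
Local Open Scope ring_scope.

(* An associative unital K-algebra structure on the ring B, given by its      *)
(* structure map s |-> s.1. Unlike algType K, this does not force 1 != 0.     *)
Record algebra_structure (K : comPzRingType) (B : pzRingType) :=
  AlgebraStructure {
    algebra_map :> {rmorphism K -> B};
    algebra_map_central : forall s b, algebra_map s * b = b * algebra_map s }.

Section Structures.
(* Structures carried by a subset A of T; the operations are functions on T   *)
(* of which only the restrictions to A matter.                                *)
Variables (T : Type) (A : set T).

Record is_torsor (p : T -> T -> T -> T) : Prop := IsTorsor {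
  torsor_closed : forall x y z, A x -> A y -> A z -> A (p x y z);
  torsor_assoc : forall x y z u v, A x -> A y -> A z -> A u -> A v ->
    p x y (p z u v) = p (p x y z) u v;
  torsor_left : forall x y, A x -> A y -> p x x y = y;
  torsor_right : forall x y, A x -> A y -> p y x x = y }.

Definition opposite_product (p : T -> T -> T -> T) x y z : T := p z y x.

Definition torsor_commutative (p : T -> T -> T -> T) : Prop :=
  forall x y z, A x -> A y -> A z -> p x y z = p z y x.

Record is_group (e : T) (mul : T -> T -> T) : Prop := IsGroup {
  group_unit : A e;
  group_closed : forall x y, A x -> A y -> A (mul x y);
  group_assoc : forall x y z, A x -> A y -> A z ->
    mul x (mul y z) = mul (mul x y) z;
  group_left_unit : forall x, A x -> mul e x = x;
  group_right_unit : forall x, A x -> mul x e = x;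
  group_inverse : forall x, A x -> exists2 x', A x' &
    mul x' x = e /\ mul x x' = e }.

Record is_module (K : comPzRingType)
    (o : T) (add : T -> T -> T) (scale : K -> T -> T) : Prop := IsModule {
  module_group : is_group o add;
  module_addC : forall x y, A x -> A y -> add x y = add y x;
  module_scale_closed : forall s x, A x -> A (scale s x);
  module_scaleDr : forall s x y, A x -> A y ->
    scale s (add x y) = add (scale s x) (scale s y);
  module_scaleDl : forall s t x, A x ->
    scale (s + t) x = add (scale s x) (scale t x);
  module_scaleA : forall s t x, A x -> scale (s * t) x = scale s (scale t x);
  module_scale1 : forall x, A x -> scale 1 x = x }.

(* t x y z stands for x - y + z and r s y x for (1 - s) y + s x: with respect *)
(* to an origin o, x + z is t x o z and s x is r s o x.                       *)
Record is_affine_space (K : comPzRingType)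
    (t : T -> T -> T -> T) (r : K -> T -> T -> T) : Prop := IsAffineSpace {
  affine_module : forall o, A o -> is_module o (fun x z => t x o z) (r^~ o);
  affine_translation_bij : forall o o', A o -> A o' ->
    set_bij A A (fun x => t x o o') /\ t o o o' = o';
  affine_translation_add : forall o o' x z, A o -> A o' -> A x -> A z ->
    t (t x o z) o o' = t (t x o o') o' (t z o o');
  affine_translation_scale : forall o o' s x, A o -> A o' -> A x ->
    t (r s o x) o o' = r s o' (t x o o');
  affine_sub_add : forall o x y z, A o -> A x -> A y -> A z ->
    t x y z = t (t x o (r (-1) o y)) o z;
  affine_combination : forall o s x y, A o -> A x -> A y ->
    r s y x = t (r (1 - s) o y) o (r s o x) }.

End Structures.

Section Grassmannian.
(* Everything that does not involve the scalars in K is stated for a left     *)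
(* R-module W. A right B-module is a left module over the converse ring       *)
(* R := B^c, with w . b := (b : B^c) *: w.                                    *)
Variables (R : pzRingType) (W : lmodType R).

Record gras := Gras {
  gras_set :> set W;
  gras_submod : GRing.submod_closed [in gras_set] }.

Implicit Types (f g : {linear W -> W}) (x a y b z : gras).

Lemma gras0 x : gras_set x 0.
Proof. by have [/set_mem] := gras_submod x. Qed.

Lemma grasP x c u v : gras_set x u -> gras_set x v -> gras_set x (c *: u + v).
Proof.
by move=> xu xv; apply: set_mem; apply: (gras_submod x).2; apply: mem_set.
Qed.

Lemma grasD x u v : gras_set x u -> gras_set x v -> gras_set x (u + v).
Proof. by move=> xu xv; rewrite -[u]scale1r; apply: grasP. Qed.

Lemma grasZ x c u : gras_set x u -> gras_set x (c *: u).
Proof. by move=> xu; rewrite -[c *: u]addr0; apply/grasP/gras0. Qed.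

Lemma grasN x u : gras_set x u -> gras_set x (- u).
Proof. by rewrite -scaleN1r; apply: grasZ. Qed.

Lemma grasB x u v : gras_set x u -> gras_set x v -> gras_set x (u - v).
Proof. by move=> xu xv; apply/grasD/grasN. Qed.

Lemma gras_ext x y : (forall w, gras_set x w <-> gras_set y w) -> x = y.
Proof.
case: x y => [x xP] [y yP] /= xy.
have {}xy : x = y by apply/seteqP; split=> w /xy.
by move: xP yP; rewrite xy => xP yP; congr Gras; apply: Prop_irrelevance.
Qed.

Lemma gras_image_submod f x : GRing.submod_closed [in f @` x].
Proof.
split=> [|c _ _ /set_mem[u xu <-] /set_mem[v xv <-]]; apply: mem_set.
  by exists 0; [exact: gras0 | exact: linear0].
by exists (c *: u + v); [exact: grasP | exact: linearP].
Qed.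

(* The action of the class [f] of f modulo K^x, computed on the               *)
(* representative f; the choice does not matter by gras_act_class.            *)
Definition gras_act f x : gras := Gras (gras_image_submod f x).

Definition transversal x a : Prop :=
  [set u + v | u in gras_set x & v in gras_set a] = setT /\
  gras_set x `&` gras_set a = [set 0].

(* P_x^a, with image x and kernel a; zero unless x and a are transversal.     *)
Definition proj x a (w : W) : W :=
  if `[< transversal x a >]
  then xget 0 [set u | gras_set x u /\ gras_set a (w - u)] else 0.

Lemma transversal_sym x a : transversal x a -> transversal a x.
Proof.
case=> xa xa0; split; last by rewrite setIC.
apply/seteqP; split=> // w _.
have [u xu [v av <-]] : [set u + v | u in gras_set x & v in gras_set a] w.
  by rewrite xa.
by exists v => //; exists u => //; rewrite addrC.
Qed.

Lemma projP x a w : transversal x a ->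
  gras_set x (proj x a w) /\ gras_set a (w - proj x a w).
Proof.
move=> xa; rewrite /proj; case: asboolP => // _.
case: xgetP => [_ _ [] // | no]; exfalso.
have [u xu [v av uvw]] : [set u + v | u in gras_set x & v in gras_set a] w.
  by rewrite xa.1.
by apply: (no u); split=> //; rewrite -uvw addrC addKr.
Qed.

Lemma proj_unique x a w u :
  transversal x a -> gras_set x u -> gras_set a (w - u) -> proj x a w = u.
Proof.
move=> xa xu au; have [xp ap] := projP w xa; apply/eqP; rewrite -subr_eq0.
suff : (gras_set x `&` gras_set a) (proj x a w - u) by rewrite xa.2 => ->.
split; first exact: grasB.
have -> : proj x a w - u = (w - u) - (w - proj x a w).
  by rewrite opprB addrCA addrAC subrr sub0r addrC.
exact: grasB.
Qed.

Lemma projC x a w : transversal x a -> proj a x w = w - proj x a w.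
Proof.
move=> xa; have [xp ap] := projP w xa.
apply: proj_unique => //; first exact: transversal_sym.
by rewrite opprB addrC subrK.
Qed.

Lemma proj_cross x z a w :
  transversal x a -> transversal z a -> gras_set z w ->
  proj z a (proj x a w) = w.
Proof.
move=> xa za zw; apply: proj_unique => //.
by rewrite -opprB; apply/grasN; case: (projP w xa).
Qed.

Lemma proj_is_linear x a : linear (proj x a).
Proof.
move=> c u v; case: (EM (transversal x a)) => xa; last first.
  by rewrite /proj; case: asboolP => // _; rewrite scaler0 addr0.
have [[xu au] [xv av]] := (projP u xa, projP v xa).
apply: proj_unique => //; first exact: grasP.
by rewrite opprD addrACA -scalerBr; apply: grasP.
Qed.

HB.instance Definition _ x a :=
  GRing.isLinear.Build R W W *:%R (proj x a) (@proj_is_linear x a).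

Definition Mop x a b z : {linear W -> W} := proj x a \- proj b z.
Definition Lop x a y b : {linear W -> W} := idfun \- (proj a x \o proj y b).
Definition Rop a y b z : {linear W -> W} := idfun \- (proj b z \o proj y a).

Definition C a : set gras := [set x | transversal x a].
Definition C2 a b : set gras := C a `&` C b.

Definition DL x a y b z : Prop := transversal x a /\ transversal y b.
Definition DR x a y b z : Prop := transversal y a /\ transversal z b.
Definition DM x a y b z : Prop :=
  [/\ transversal x a, transversal z b & C2 a b !=set0].
Definition DGamma x a y b z : Prop :=
  [\/ DL x a y b z, DR x a y b z | DM x a y b z].

(* A total extension of Gamma, whose values outside DGamma are irrelevant.    *)
(* Lemmas GammaL, GammaR and GammaM show that the three formulas agree where  *)
(* their domains overlap.                                                     *)
Definition Gamma x a y b z : gras :=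
  if `[< DL x a y b z >] then gras_act (Lop x a y b) z
  else if `[< DR x a y b z >] then gras_act (Rop a y b z) x
  else gras_act (Mop x a b z) y.

Definition Uprod a b x y z : gras := Gamma x a y b z.

(* A description of Gamma that is common to the three formulas.               *)
Definition Gamma_spec x a y b z (w : W) : Prop := exists al be,
  [/\ gras_set a al, gras_set b be, gras_set z (w - al),
      gras_set x (w - be) & gras_set y (w - al - be)].

Lemma LopP x a y b z w : DL x a y b z ->
  gras_set (gras_act (Lop x a y b) z) w <-> Gamma_spec x a y b z w.
Proof.
move=> [/transversal_sym ax yb].
split=> [[u zu <-] | [al [be [aa bb zz xx yy]]]].
  have [yp bp] := projP u yb; have [] := projP (proj y b u) ax.
  rewrite /Lop /=; set p := proj y b u; set q := proj a x p => aq xq.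
  have e : u - q + q = u by rewrite subrK.
  exists (- q), (u - p); rewrite opprK e; split=> //; first exact: grasN.
    by rewrite opprB addrAC addrCA subrr addr0.
  by rewrite opprB addrC subrK.
exists (w - al) => //=.
have -> : proj y b (w - al) = w - al - be.
  by apply: proj_unique => //; rewrite opprB addrC subrK.
suff -> : proj a x (w - al - be) = - al by rewrite opprK subrK.
apply: proj_unique => //; first exact: grasN.
by rewrite opprK addrAC subrK.
Qed.

Lemma RopP x a y b z w : DR x a y b z ->
  gras_set (gras_act (Rop a y b z) x) w <-> Gamma_spec x a y b z w.
Proof.
move=> [ya /transversal_sym bz].
split=> [[u xu <-] | [al [be [aa bb zz xx yy]]]].
  have [yp ap] := projP u ya; have [] := projP (proj y a u) bz.
  rewrite /Rop /=; set p := proj y a u; set q := proj b z p => bq zq.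
  have e : u - q - (u - p) = p - q by rewrite opprB addrC addrA subrK.
  by exists (u - p), (- q); rewrite e opprK !subrK; split=> //; apply: grasN.
exists (w - be) => //=.
have -> : proj y a (w - be) = w - al - be.
  rewrite [w - al - be]addrAC; rewrite addrAC in yy.
  by apply: proj_unique => //; rewrite subKr.
suff -> : proj b z (w - al - be) = - be by rewrite opprK subrK.
apply: proj_unique => //; first exact: grasN.
by rewrite opprK subrK.
Qed.

Lemma MopP x a y b z w : DM x a y b z ->
  gras_set (gras_act (Mop x a b z) y) w <-> Gamma_spec x a y b z w.
Proof.
move=> [xa /transversal_sym bz _].
split=> [[u yu <-] | [al [be [aa bb zz xx yy]]]].
  have [xp ap] := projP u xa; have [] := projP u bz.
  rewrite /Mop /=; set p := proj x a u; set q := proj b z u => bq zq.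
  have e : p - q - (p - u) = u - q by rewrite opprB addrC addrA subrK.
  exists (p - u), (- q); rewrite e opprK !subrK; split=> //; try exact: grasN.
  by rewrite -opprB; apply: grasN.
exists (w - al - be) => //=.
have -> : proj x a (w - al - be) = w - be.
  apply: proj_unique => //.
  by rewrite opprB addrA subrK addrAC subrr add0r; apply: grasN.
have -> : proj b z (w - al - be) = - be; last by rewrite opprK subrK.
by apply: proj_unique; rewrite ?opprK ?subrK //; apply: grasN.
Qed.

Lemma GammaP x a y b z w : DGamma x a y b z ->
  gras_set (Gamma x a y b z) w <-> Gamma_spec x a y b z w.
Proof.
move=> D; rewrite /Gamma; case: asboolP => [|nL]; first exact: LopP.
case: asboolP => [|nR]; first exact: RopP.
by apply: MopP; case: D.
Qed.

Lemma GammaL x a y b z :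
  DL x a y b z -> Gamma x a y b z = gras_act (Lop x a y b) z.
Proof.
by move=> D; apply: gras_ext => w; rewrite GammaP ?LopP //; apply: Or31.
Qed.

Lemma GammaR x a y b z :
  DR x a y b z -> Gamma x a y b z = gras_act (Rop a y b z) x.
Proof.
by move=> D; apply: gras_ext => w; rewrite GammaP ?RopP //; apply: Or32.
Qed.

Lemma GammaM x a y b z :
  DM x a y b z -> Gamma x a y b z = gras_act (Mop x a b z) y.
Proof.
by move=> D; apply: gras_ext => w; rewrite GammaP ?MopP //; apply: Or33.
Qed.

End Grassmannian.

Section Dilation.
Variables (K : comPzRingType) (B : pzRingType) (i : algebra_structure K B).
Variable W : lmodType B^c.
Implicit Types (f : {linear W -> W}) (x a z : gras W).

(* The action of s in K on a B-linear map, w |-> f(w) . s1.                   *)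
Definition kscale (s : K) f (w : W) : W := (i s : B^c) *: f w.

Lemma kscale_is_linear s f : linear (kscale s f).
Proof.
move=> c u v; rewrite /kscale linearP scalerDr !scalerA.
by congr (_ *: _ + _); rewrite -[LHS]/((c : B) * i s) -algebra_map_central.
Qed.

HB.instance Definition _ s f :=
  GRing.isLinear.Build B^c W W *:%R (kscale s f) (@kscale_is_linear s f).

Lemma gras_act_class s t f x : s * t = 1 -> gras_act (kscale s f) x = gras_act f x.
Proof.
move=> st; have ist : (i s : B^c) * i t = 1.
  by rewrite -[LHS]/((i t : B) * i s) -rmorphM mulrC st rmorph1.
apply: gras_ext => w; split=> -[u xu <-].
  by exists ((i s : B^c) *: u); [exact: grasZ | rewrite linearZ].
exists ((i t : B^c) *: u); first exact: grasZ.
by rewrite /= /kscale linearZ scalerA ist scale1r.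
Qed.

Definition delta (s : K) x a : {linear W -> W} := kscale s (proj a x) \+ proj x a.

Definition DPi x a z : Prop := transversal x a \/ transversal z a.

(* A total extension of Pi_s, whose values outside DPi are irrelevant. Lemmas *)
(* PiL and PiR show that the two formulas agree where their domains overlap.  *)
Definition Pi (s : K) x a z : gras W :=
  if `[< transversal x a >] then gras_act (delta s x a) z
  else gras_act (delta (1 - s) z a) x.

Lemma PiL s x a z : transversal x a -> Pi s x a z = gras_act (delta s x a) z.
Proof. by rewrite /Pi; case: asboolP. Qed.

Lemma PiR s x a z : transversal z a -> Pi s x a z = gras_act (delta (1 - s) z a) x.
Proof.
move=> za; rewrite /Pi; case: asboolP => // xa.
have sB v : (i (1 - s) : B^c) *: v = v - (i s : B^c) *: v.
  by rewrite rmorphB rmorph1 scalerBl scale1r.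
apply: gras_ext => w; split=> -[u uP <-]; rewrite /= /kscale.
  exists (proj x a u); first by case: (projP u xa).
  rewrite /= /kscale (projC _ za) (projC _ xa) proj_cross // sB.
  by rewrite -[u - proj x a u]opprB scalerN addrAC subrK addrC.
exists (proj z a u); first by case: (projP u za).
rewrite /= /kscale (projC _ za) (projC _ xa) proj_cross // sB.
by rewrite -[proj z a u - u]opprB scalerN addrAC subrK addrC.
Qed.

End Dilation.

(* Main.v *)
Require Import Defs.
From mathcomp Require Import all_boot all_order all_algebra.
From mathcomp Require Import boolp classical_sets functions.

Set Implicit Arguments.
Unset Strict Implicit.
Unset Printing Implicit Defensive.

Import GRing.Theory.
Local Open Scope ring_scope.

(** For x, y in C_ab the operator L_xayb = 1 - P_a^x P_y^b is the identity on b
    and the identity modulo a, and carries y to x along a; these properties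
    determine it. Hence L_xayb L_zaub = L_(xyz)aub, which is the torsor law, and
    L_xayb has inverse L_yaxb, whence stability of C_ab. The symmetry of Gamma
    is visible on [Gamma_spec]. For a = b, the map x |-> P_x^a is injective on
    C_a and affine: it sends (xyz) to P_x - P_y + P_z and Pi_s(x, a, y) to
    (1 - s) P_x + s P_y, so the affine structure is that of End(W). *)

(* finset also has a [transversal]. *)
Local Notation transversal := Defs.transversal.

(** * Groups and translations in an abstract torsor *)

Section Torsor.
Variables (T : Type) (A : set T) (p : T -> T -> T -> T).
Hypothesis pT : is_torsor A p.

Lemma torsor_group e : A e -> is_group A e (fun x z => p x e z).
Proof.
move=> Ae; split=> //.
- by move=> x y Ax Ay; apply: (torsor_closed pT).
- by move=> x y z Ax Ay Az; apply: (torsor_assoc pT).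
- by move=> x Ax; apply: (torsor_left pT).
- by move=> x Ax; apply: (torsor_right pT).
(* In group notation (xyz) is x y^-1 z, so (exe) is the inverse of [x] when [e] is the unit. *)
move=> x Ax; exists (p e x e); first exact: (torsor_closed pT).
split.
  by rewrite -(torsor_assoc pT) // (torsor_left pT) // (torsor_right pT).
by rewrite (torsor_assoc pT) // (torsor_right pT) // (torsor_left pT).
Qed.

Lemma torsor_translationK o o' x : A o -> A o' -> A x ->
  p (p x o o') o' o = x.
Proof.
move=> Ao Ao' Ax.
by rewrite -(torsor_assoc pT) // (torsor_left pT) // (torsor_right pT).
Qed.

Lemma torsor_translation_bij o o' : A o -> A o' ->
  set_bij A A (fun x => p x o o').
Proof.
move=> Ao Ao'; split=> [x Ax|x y /set_mem Ax /set_mem Ay xy|x Ax].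
- exact: (torsor_closed pT).
- by rewrite -(torsor_translationK Ao Ao' Ax) xy torsor_translationK.
- exists (p x o' o); first exact: (torsor_closed pT).
  exact: torsor_translationK.
Qed.

Lemma torsor_translation_add o o' x z : A o -> A o' -> A x -> A z ->
  p (p x o z) o o' = p (p x o o') o' (p z o o').
Proof.
move=> Ao Ao' Ax Az; have Azo := torsor_closed pT Az Ao Ao'.
by rewrite -!(torsor_assoc pT) // (torsor_left pT).
Qed.

End Torsor.

(** * Complements of a submodule and their projectors *)

Section Grassmannian.
Variables (R : pzRingType) (W : lmodType R).
Implicit Types (x a y b z u : gras W) (f g : {linear W -> W}) (v w : W).

Lemma transversal_intro x a :
  (forall w, exists2 v, gras_set x v & gras_set a (w - v)) ->
  (forall w, gras_set x w -> gras_set a w -> w = 0) -> transversal x a.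
Proof.
move=> xa xa0; split.
  apply/seteqP; split=> // w _; have [v xv av] := xa w.
  by exists v => //; exists (w - v) => //; rewrite addrC subrK.
apply/seteqP; split=> [w [xw aw]|_ ->]; first exact: xa0.
by split; apply: gras0.
Qed.

Lemma transversal_eq0 x a w :
  transversal x a -> gras_set x w -> gras_set a w -> w = 0.
Proof. by move=> xa xw aw; have : [set 0]%classic w by rewrite -xa.2. Qed.

Lemma proj_id x a w : transversal x a -> gras_set x w -> proj x a w = w.
Proof. by move=> xa xw; apply: proj_unique; rewrite ?subrr //; apply: gras0. Qed.

Lemma proj_eq0 x a w : transversal x a -> gras_set a w -> proj x a w = 0.
Proof. by move=> xa aw; apply: proj_unique; rewrite ?subr0 //; apply: gras0. Qed.

Lemma proj_proj x y a w : transversal x a -> transversal y a ->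
  proj x a (proj y a w) = proj x a w.
Proof.
move=> xa ya; apply/esym/eqP; rewrite -subr_eq0 -linearB /= (proj_eq0 xa) //.
by case: (projP w ya).
Qed.

Lemma proj_inj x y a : transversal x a -> transversal y a ->
  (forall w, proj x a w = proj y a w) -> x = y.
Proof.
move=> xa ya xy; apply: gras_ext => w; split=> Hw.
  by rewrite -(proj_id xa Hw) xy; case: (projP w ya).
by rewrite -(proj_id ya Hw) -xy; case: (projP w xa).
Qed.

(** An automorphism preserving [a] in both directions carries the decomposition of [g w] along x + a
    to one of [w] along f(x) + a. *)
Lemma transversal_gras_act f g x a : cancel f g -> cancel g f ->
  (forall w, gras_set a w -> gras_set a (f w)) ->
  (forall w, gras_set a w -> gras_set a (g w)) ->
  transversal x a -> transversal (gras_act f x) a.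
Proof.
move=> fK gK fa ga xa; apply: transversal_intro => [w|_ [v xv <-] av].
  have [xp ap] := projP (g w) xa; exists (f (proj x a (g w))).
    by exists (proj x a (g w)).
  by rewrite -{1}(gK w) -linearB; apply: fa.
by rewrite (transversal_eq0 xa xv) ?linear0 // -[v]fK; apply: ga.
Qed.

(** * The operators L_xayb *)

Lemma Lop_sub x a y b w : transversal x a -> gras_set a (w - Lop x a y b w).
Proof.
move=> xa; rewrite /Lop /= subKr.
by case: (projP (proj y b w) (transversal_sym xa)).
Qed.

Lemma Lop_id x a y b w : transversal y b -> gras_set b w -> Lop x a y b w = w.
Proof. by move=> yb bw; rewrite /Lop /= (proj_eq0 yb) // linear0 subr0. Qed.

Lemma Lop_stable x a y b w : transversal x a ->
  gras_set a w -> gras_set a (Lop x a y b w).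
Proof.
move=> xa aw; rewrite -[Lop _ _ _ _ _](subKr w); apply: grasB => //.
exact: Lop_sub.
Qed.

Lemma Lop_xx x a b w : transversal x a -> transversal x b ->
  Lop x a x b w = w.
Proof.
move=> xa xb; rewrite /Lop /= (proj_eq0 (transversal_sym xa)) ?subr0 //.
by case: (projP w xb).
Qed.

(** On [y] the projector P_y^b is the identity, so L_xayb restricts to 1 - P_a^x = P_x^a, which maps
    one complement of [a] onto the other. *)
Lemma Lop_act x a y b : transversal x a -> transversal y a ->
  transversal y b -> gras_act (Lop x a y b) y = x.
Proof.
move=> xa ya yb.
have Ly v : gras_set y v -> Lop x a y b v = proj x a v.
  by move=> yv; rewrite /Lop /= (proj_id yb) // projC // subKr.
apply: gras_ext => w; split=> [[v yv <-]|xw].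
  by rewrite Ly //; case: (projP v xa).
have [yp _] := projP w ya.
by exists (proj y a w) => //; rewrite Ly // proj_cross.
Qed.

Lemma Lop_comp x a y b z u w :
  transversal x a -> transversal y b -> transversal z a -> transversal u b ->
  transversal (gras_act (Lop x a y b) z) a ->
  Lop x a y b (Lop z a u b w) = Lop (gras_act (Lop x a y b) z) a u b w.
Proof.
move=> xa yb za ub xyza; set L := Lop x a y b; set p := proj u b w.
have [aq zq] := projP p (transversal_sym za); set q := proj a z p in aq zq.
(* Both sides equal [w - p + L (p - q)]. Here [p - q] lies in [z], so [L (p - q)] lies in L(z) and
   is congruent to [p] modulo [a]: it is the L(z)-component of [p]. On the other side, [L] fixes
   [w - p], which lies in [b]. *)
have -> : Lop (gras_act L z) a u b w = w - p + L (p - q).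
  rewrite [LHS]/= -/p.
  rewrite (@proj_unique _ _ _ _ _ (p - L (p - q)) (transversal_sym xyza)).
  - by rewrite opprB addrA addrAC.
  - rewrite -(subrK q p) addrAC subrK; apply: grasD => //; exact: Lop_sub.
  - by rewrite subKr; exists (p - q).
have -> : Lop z a u b w = (w - p) + (p - q) by rewrite addrA subrK.
rewrite linearD; congr (_ + _); apply: Lop_id => //.
by case: (projP w ub).
Qed.

(** Since L_xayb carries y to x, the composition law gives L_xayb L_yaxb = L_xaxb, the identity. *)
Lemma LopK x a y b : C2 a b x -> C2 a b y ->
  cancel (Lop y a x b) (Lop x a y b).
Proof.
move=> [xa xb] [ya yb] w; have xy := Lop_act xa ya yb.
by rewrite Lop_comp // xy // Lop_xx.
Qed.

(** L_xayb and its inverse L_yaxb preserve [a] and fix [b] pointwise, so they keep complements of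
    both. *)
Lemma C2_Lop x a y b z : C2 a b x -> C2 a b y -> C2 a b z ->
  C2 a b (gras_act (Lop x a y b) z).
Proof.
move=> Cx Cy [za zb]; have [xa xb] := Cx; have [ya yb] := Cy.
split; apply: (@transversal_gras_act _ (Lop y a x b)) => //;
  try exact: LopK; move=> w Hw; by [apply: Lop_stable | rewrite Lop_id].
Qed.

Lemma GammaC2 x a y b z : C2 a b x -> C2 a b y ->
  Gamma x a y b z = gras_act (Lop x a y b) z.
Proof. by move=> [xa _] [_ yb]; rewrite GammaL. Qed.

Lemma C2_torsor a b : is_torsor (C2 a b) (fun x y z => Gamma x a y b z).
Proof.
split=> [x y z Cx Cy Cz|x y z u v Cx Cy Cz Cu Cv|x y Cx Cy|x y Cx Cy].
- by rewrite GammaC2 //; apply: C2_Lop.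
- have Cxyz := C2_Lop Cx Cy Cz.
  have [[xa _] [_ yb] [za _] [_ ub]] := And4 Cx Cy Cz Cu.
  (* Both sides are images of [v], under L_xayb L_zaub and under L_(xyz)aub. *)
  rewrite !GammaC2 //; apply: gras_ext => w; split.
    by case=> _ [t vt <-] <-; exists t; rewrite // Lop_comp //; case: Cxyz.
  case=> t vt <-; exists (Lop z a u b t); first by exists t.
  by rewrite Lop_comp //; case: Cxyz.
- have [xa xb] := Cx; rewrite GammaC2 //; apply: gras_ext => w.
  by split=> [[t yt <-]|yw]; [|exists w]; rewrite ?Lop_xx.
- by rewrite GammaC2 // Lop_act //; case: Cx Cy => ? ? [].
Qed.

(** * Reversal of the arguments of Gamma *)

Lemma DGamma_rev x a y b z : DGamma x a y b z -> DGamma z b y a x.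
Proof.
case=> [[xa yb]|[ya zb]|[xa zb [c [ca cb]]]].
- exact: Or32.
- exact: Or31.
- by apply: Or33; split=> //; exists c.
Qed.

(** The witnesses [al] and [be] exchange roles, and the condition on [y] is symmetric in them. *)
Lemma Gamma_spec_rev x a y b z w :
  Gamma_spec x a y b z w -> Gamma_spec z b y a x w.
Proof.
by case=> al [be [*]]; exists be, al; split=> //; rewrite addrAC.
Qed.

Lemma Gamma_rev x a y b z :
  DGamma x a y b z -> Gamma x a y b z = Gamma z b y a x.
Proof.
move=> D; apply: gras_ext => w; rewrite !GammaP //; last exact: DGamma_rev.
by split; apply: Gamma_spec_rev.
Qed.

Lemma C2_rev a b x y z : C2 a b x -> C2 a b y -> C2 a b z ->
  Gamma x a y b z = Gamma z b y a x.
Proof. by move=> [xa _] [_ yb] _; apply/Gamma_rev/Or31. Qed.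

Lemma proj_Gamma a x y z w :
  transversal x a -> transversal y a -> transversal z a ->
  proj (Gamma x a y a z) a w = proj x a w - proj y a w + proj z a w.
Proof.
move=> xa ya za; apply: proj_unique.
- have Caa u : transversal u a -> C2 a a u by [].
  by case: (torsor_closed (C2_torsor a a) (Caa x xa) (Caa y ya) (Caa z za)).
(* The proposed value is L_xaya(P_z^a w), because P_x P_y P_z = P_x and P_y P_z = P_y for projectors
   with kernel [a]. *)
- rewrite GammaL //; exists (proj z a w); first by case: (projP w za).
  by rewrite /= (projC _ xa) !proj_proj // opprB [RHS]addrC.
have -> : w - (proj x a w - proj y a w + proj z a w) =
    (w - proj x a w) + ((w - proj z a w) - (w - proj y a w)).
  rewrite [- (w - proj y a w)]opprB [X in _ = _ + X]addrC subrKA.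
  by rewrite opprD opprB [proj y a w - proj x a w]addrC -addrA; apply: addrA.
have aB u : transversal u a -> gras_set a (w - proj u a w).
  by move=> /(projP w)[].
by apply: grasD; [exact: aB | apply: grasB; exact: aB].
Qed.

End Grassmannian.

(** * Displacement coordinates and the affine structure on C_a *)

Section Affine.
Variables (K : comPzRingType) (B : pzRingType) (i : algebra_structure K B).
Variables (W : lmodType B^c) (a : gras W).
Implicit Types (o x y z : gras W) (v w : W) (s t : K).

Local Notation A := (C2 a a).
Local Notation "s **: v" := ((i s : B^c) *: v) (at level 40).

Lemma C2aa x : A x <-> transversal x a.
Proof. by split=> [[]|]. Qed.

(** The operator need not be invertible, but it agrees with P_o^a modulo [a], and P_o^a restricts to
    a bijection from [x] onto [o]. *)
Lemma transversal_delta s o x : transversal o a -> transversal x a ->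
  transversal (gras_act (delta i s o a) x) a.
Proof.
move=> oa xa.
have da v : gras_set a (delta i s o a v - proj o a v).
  rewrite /= addrK /kscale; apply: grasZ.
  by case: (projP v (transversal_sym oa)).
apply: transversal_intro => [w|_ [v xv <-] av].
  have [xp ap] := projP w xa.
  exists (delta i s o a (proj x a w)); first by exists (proj x a w).
  rewrite -(subrKA (proj o a w)); apply: grasD; first by case: (projP w oa).
  by rewrite -(proj_proj w oa xa) -opprB; apply: grasN.
have ov : proj o a v = 0.
  rewrite -(subKr (delta i s o a v) (proj o a v)).
  apply: (transversal_eq0 oa); last by apply: grasB.
  by rewrite subKr; case: (projP v oa).
by rewrite -(proj_cross oa xa xv) ov !linear0.
Qed.

(** The coordinate P_x^a - P_o^a of [x] with origin [o]; it is injective on C_a, so affine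
    identities can be checked in End(W). *)
Definition disp o x w : W := proj x a w - proj o a w.

Lemma disp_inj o x y : A x -> A y ->
  (forall w, disp o x w = disp o y w) -> x = y.
Proof.
move=> /C2aa xa /C2aa ya xy; apply: (proj_inj xa ya) => w.
exact: (addIr (- proj o a w) (xy w)).
Qed.

Lemma disp_base o o' x w : disp o' x w = disp o x w - disp o o' w.
Proof. by rewrite /disp opprB addrA subrK. Qed.

Lemma disp_Gamma o x y z w : A x -> A y -> A z ->
  disp o (Gamma x a y a z) w = disp o x w - disp o y w + disp o z w.
Proof.
move=> /C2aa xa /C2aa ya /C2aa za.
by rewrite -disp_base /disp proj_Gamma // addrA.
Qed.

Lemma disp_add o x z w : A o -> A x -> A z ->
  disp o (Gamma x a o a z) w = disp o x w + disp o z w.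
Proof.
by move=> Ao Ax Az; rewrite disp_Gamma // [disp o o w]subrr subr0.
Qed.

Lemma Pi_closed s o x : A o -> A x -> A (Pi i s o a x).
Proof.
move=> /C2aa oa /C2aa xa; apply/C2aa.
by rewrite PiL //; apply: transversal_delta.
Qed.

Lemma disp_Pi s o x w : A o -> A x ->
  disp o (Pi i s o a x) w = s **: disp o x w.
Proof.
move=> Ao Ax; have [/C2aa oa /C2aa xa] := (Ao, Ax).
have /C2aa := Pi_closed s Ao Ax; rewrite /disp PiL // => da.
(* Composing delta with P_x^a gives P_o^a + s (P_x^a - P_o^a), whose displacement from [o] is
   visibly scaled by [s]. *)
suff -> : proj (gras_act (delta i s o a) x) a w = delta i s o a (proj x a w).
  by rewrite /= /kscale /= (projC _ oa) proj_proj // addrK.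
apply: proj_unique => //; first by exists (proj x a w); case: (projP w xa).
rewrite /= /kscale /= (projC _ oa) proj_proj // opprD addrA addrAC; apply: grasB.
  by case: (projP w oa).
apply: grasZ; rewrite -(subrKA w) addrC -[proj x a w - w]opprB.
by apply: grasB; [case: (projP w oa) | case: (projP w xa)].
Qed.

Lemma C2_commutative : torsor_commutative A (Uprod a a).
Proof. by move=> x y z Ax Ay Az; apply: C2_rev. Qed.

Lemma C2_module o : A o ->
  is_module A o (fun x z => Gamma x a o a z) (fun s x => Pi i s o a x).
Proof.
move=> Ao; have tT := C2_torsor a a.
have Aadd x z : A x -> A z -> A (Gamma x a o a z).
  by move=> Ax Az; apply: (torsor_closed tT).
have Ascale s x : A x -> A (Pi i s o a x) by apply: Pi_closed.
split=> //.
- exact: (torsor_group tT).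
- by move=> x y Ax Ay; apply: C2_commutative.
- move=> s x y Ax Ay; apply: (disp_inj (o := o)); auto => w.
  by rewrite disp_Pi ?disp_add ?disp_Pi ?scalerDr; auto.
- move=> s t x Ax; apply: (disp_inj (o := o)); auto => w.
  by rewrite disp_add ?disp_Pi ?rmorphD ?scalerDl; auto.
- move=> s t x Ax; apply: (disp_inj (o := o)); auto => w.
  (* Products in [B^c] are reversed; commutativity of [K] restores the order. *)
  by rewrite !disp_Pi ?scalerA; auto; rewrite mulrC rmorphM.
- move=> x Ax; apply: (disp_inj (o := o)); auto => w.
  by rewrite disp_Pi // rmorph1 scale1r.
Qed.

Lemma C2_affine : is_affine_space A (fun x y z => Gamma x a y a z)
  (fun s x y => Pi i s x a y).
Proof.
have tT := C2_torsor a a.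
have At x y z : A x -> A y -> A z -> A (Gamma x a y a z).
  exact: (torsor_closed tT).
have Ar s o x : A o -> A x -> A (Pi i s o a x) by apply: Pi_closed.
split.
- exact: C2_module.
- move=> o o' Ao Ao'; split; first exact: (torsor_translation_bij tT).
  exact: (torsor_left tT).
- by move=> *; apply: (torsor_translation_add tT).
- move=> o o' s x Ao Ao' Ax; apply: (disp_inj (o := o')); auto => w.
  (* Changing origin subtracts [disp o o'], which cancels the translation; both sides become s times
     [disp o x]. *)
  rewrite disp_Pi; auto; rewrite !(disp_base o o').
  by rewrite !disp_add ?disp_Pi ?addrK; auto.
- move=> o x y z Ao Ax Ay Az; apply: (disp_inj (o := o)); auto => w.
  rewrite disp_Gamma ?disp_add ?disp_Pi; auto.
  by rewrite rmorphN1 scaleN1r.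
- move=> o s x y Ao Ax Ay; apply: (disp_inj (o := o)); auto => w.
  (* This dilation is centred at [y], so its scaling is read off with origin [y] before returning to
     [o]. *)
  have -> : disp o (Pi i s y a x) w = disp y (Pi i s y a x) w + disp o y w.
    by rewrite (disp_base o y) subrK.
  rewrite disp_add ?disp_Pi; auto; rewrite (disp_base o y).
  by rewrite rmorphB rmorph1 scalerBl scale1r scalerBr addrC addrA addrAC.
Qed.

End Affine.

Theorem theorem1p2 (K : comPzRingType) (B : pzRingType)
    (i : algebra_structure K B) (W : lmodType B^c) :
  (* (i) *)
  ((forall a b : gras W,
      is_torsor (C2 a b) (fun x y z => Gamma x a y b z))
   /\
   (forall a y b : gras W, C2 a b y ->
      is_group (C2 a b) y (fun x z => Gamma x a y b z)))
  /\
  (* (ii) *)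
  ((forall x a y b z : gras W, DGamma x a y b z ->
      DGamma z b y a x /\ Gamma x a y b z = Gamma z b y a x)
   /\
   (forall a b : gras W,
      C2 a b = C2 b a /\
      forall x y z, C2 a b x -> C2 a b y -> C2 a b z ->
        Uprod a b x y z = opposite_product (Uprod b a) x y z)
   /\
   (forall a : gras W, torsor_commutative (C2 a a) (Uprod a a)))
  /\
  (* (iii) *)
  (forall a : gras W,
     is_affine_space (C2 a a) (fun x y z => Gamma x a y a z)
       (fun s x y => Pi i s x a y)).
Proof.
split; [split | split; [split; [|split] |]].
- exact: C2_torsor.
- by move=> a y b Cy; apply: (torsor_group (C2_torsor a b)).
- by move=> x a y b z D; split; [exact: DGamma_rev | exact: Gamma_rev].
- move=> a b; split=> [|x y z Cx Cy Cz]; last exact: C2_rev.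
  exact: setIC.
- exact: C2_commutative.
- exact: C2_affine.
Qed.
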